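(* Let $\{(d_i,n_i,c_i),i\in\mathcal I\}$ be ESP data and let $(Z,Y)$ be a solution of the ESP for some $X\in\mathcal C_G$. Suppose the ESP satisfies the set-$B$ condition. Then there exists $\kappa_\Lambda\in(0,\infty)$ such that if $(\phi_1,\eta_1)$ solves the derivative problem associated with $Z$ for $\psi_1\in\mathcal D_r$ and $(\phi_2,\eta_2)$ solves the derivative problem associated with $Z$ for $\psi_2\in\mathcal D_r$, then for all $T\in[0,\infty)$, $$\sup_{s\in[0,T]}|\phi_1(s)-\phi_2(s)|\le\kappa_\Lambda\sup_{s\in[0,T]}|\psi_1(s)-\psi_2(s)|.$$ As a consequence, for every $\psi\in\mathcal D_r$ there is at most one solution to the derivative problem associated with $Z$ for $\psi$.
   Context: $\mathrm{cone}(A)$ is the set of finite nonnegative linear combinations of elements of $A\subseteq\mathbb R^J$, $\mathrm{span}(A)$ the linear span; both are $\{0\}$ for $A=\emptyset$. $\mathcal C$: continuous functions $[0,\infty)\to\mathbb R^J$; $\mathcal C_G=\{f\in\mathcal C:f(0)\in G\}$; $\mathcal D_r$: right continuous functions $[0,\infty)\to\mathbb R^J$ with finite left limits. ESP data. $\mathcal I=\{1,\dots,N\}$; $n_i\in\mathbb R^J$ are unit vectors, $d_i\in\mathbb R^J$ with $\langle d_i,n_i\rangle=1$, $c_i\in\mathbb R$, and $G=\bigcap_{i\in\mathcal I}\{x:\langle x,n_i\rangle\ge c_i\}$ is the closure of a nonempty convex polyhedral domain. $F_i=\{x\in\partial G:\langle x,n_i\rangle=c_i\}$; for $x\in G$,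 $\mathcal I(x)=\{i:x\in F_i\}$; $d(x)=\mathrm{cone}(\{d_i:i\in\mathcal I(x)\})$ for $x\in\partial G$ and $d(x)=\{0\}$ for $x\in G^\circ$; $H_x=\bigcap_{i\in\mathcal I(x)}\{y:\langle y,n_i\rangle=0\}$ for $x\in\partial G$, $H_x=\mathbb R^J$ for $x\in G^\circ$. ESP: $(Z,Y)\in\mathcal C\times\mathcal C$ solves the ESP for $X\in\mathcal C$ if $Y(0)\in d(Z(0))$ and for all $t\ge0$: $Z(t)=X(t)+Y(t)$; $Z(t)\in G$; $Y(t)-Y(s)\in\mathrm{cone}[\cup_{u\in(s,t]}d(Z(u))]$ for all $s\in[0,t)$. Set-$B$ condition: there exist $\delta>0$ and a compact, convex, symmetric set $B$ with $0\in B^\circ$ such that for every $i\in\mathcal I$: if $z\in\partial B$ and $|\langle z,n_i\rangle|<\delta$ then $\langle\nu,d_i\rangle=0$ for all unit vectors $\nu$ with $\langle\nu,y-z\rangle\ge0$ for all $y\in B$. Derivative problem: $(\phi,\eta)\in\mathcal D_r\times\mathcal D_r$ solves the derivative problem associated with $Z$ for $\psi\in\mathcal D_r$ if $\eta(0)\in\mathrm{span}[d(Z(0))]$ and for all $t\ge0$: $\phi(t)=\psi(t)+\eta(t)$; $\phi(t)\in H_{Z(t)}$; $\eta(t)-\eta(s)\in\mathrm{span}[\cup_{u\in(s,t]}d(Z(u))]$ for all $s\in[0,t)$. *)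

(* Defs.v *)
From HB Require Import structures.
From mathcomp Require Import all_boot all_order all_algebra.
From mathcomp Require Import all_classical all_reals all_analysis.

Set Implicit Arguments.
Unset Strict Implicit.
Unset Printing Implicit Defensive.

Import Order.TTheory GRing.Theory Num.Theory.
Import numFieldNormedType.Exports.

Local Open Scope classical_set_scope.
Local Open Scope ring_scope.

(* The topology of 'rV[R]_J is the usual one, but the library's norm `|x| on
   'rV[R]_J is the sup norm, so the Euclidean norm is introduced separately. *)
Definition dotv (R : realType) (J : nat) (u v : 'rV[R]_J) : R :=
  \sum_(k < J) u 0 k * v 0 k.

Definition enorm (R : realType) (J : nat) (u : 'rV[R]_J) : R :=
  Num.sqrt (dotv u u).

(* The case m = 0 gives cone set0 = span set0 = {0}. *)
Definition cone (R : realType) (J : nat) (A : set 'rV[R]_J) : set 'rV[R]_J :=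
  [set v | exists (m : nat) (a : 'I_m -> R) (x : 'I_m -> 'rV[R]_J),
     (forall k, 0 <= a k /\ A (x k)) /\ v = \sum_(k < m) a k *: x k].

Definition lspan (R : realType) (J : nat) (A : set 'rV[R]_J) : set 'rV[R]_J :=
  [set v | exists (m : nat) (a : 'I_m -> R) (x : 'I_m -> 'rV[R]_J),
     (forall k, A (x k)) /\ v = \sum_(k < m) a k *: x k].

Definition boundary (T : topologicalType) (A : set T) : set T :=
  closure A `\` A°.

Section ESP.
Variables (R : realType) (J N : nat).
Implicit Types (d n : 'I_N -> 'rV[R]_J) (c : 'I_N -> R) (x : 'rV[R]_J).

(* Functions on [0, +oo[ are represented by functions on R of which only the
   values at nonnegative times matter. *)
Definition continuous_path (f : R -> 'rV[R]_J) : Prop := {within `[0, +oo[, continuous f}.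

Definition rcll (f : R -> 'rV[R]_J) : Prop :=
  (forall t, 0 <= t -> f s @[s --> t^'+] --> f t) /\
  (forall t, 0 < t -> cvg (f s @[s --> t^'-])).

Definition polyhedron n c : set 'rV[R]_J :=
  \bigcap_(i in [set: 'I_N]) [set x | c i <= dotv x (n i)].

Definition open_polyhedron n c : set 'rV[R]_J :=
  \bigcap_(i in [set: 'I_N]) [set x | c i < dotv x (n i)].

Record ESP_data d n c : Prop := {
  ESP_unit : forall i, enorm (n i) = 1 ;
  ESP_normalized : forall i, dotv (d i) (n i) = 1 ;
  ESP_domain_neq0 : open_polyhedron n c !=set0 ;
  ESP_closure : polyhedron n c = closure (open_polyhedron n c) }.

Definition face n c (i : 'I_N) : set 'rV[R]_J :=
  [set x | boundary (polyhedron n c) x /\ dotv x (n i) = c i].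

Definition active n c x : set 'I_N := [set i | face n c i x].

Definition dcone d n c x : set 'rV[R]_J :=
  if x \in boundary (polyhedron n c) then cone (d @` active n c x)
  else [set 0].

Definition Htan n c x : set 'rV[R]_J :=
  if x \in boundary (polyhedron n c)
  then \bigcap_(i in active n c x) [set y | dotv y (n i) = 0]
  else setT.

Record solves_ESP d n c (X Z Y : R -> 'rV[R]_J) : Prop := {
  sESP_Z : continuous_path Z ;
  sESP_Y : continuous_path Y ;
  sESP_init : dcone d n c (Z 0) (Y 0) ;
  sESP_sum : forall t, 0 <= t -> Z t = X t + Y t ;
  sESP_in : forall t, 0 <= t -> polyhedron n c (Z t) ;
  sESP_incr : forall s t, 0 <= s -> s < t ->
    cone (\bigcup_(u in `]s, t]) dcone d n c (Z u)) (Y t - Y s) }.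

Record is_setB d n (delta : R) (B : set 'rV[R]_J) : Prop := {
  setB_compact : compact B ;
  setB_convex : convex_set (B : set (convex_lmodType 'rV[R]_J)) ;
  setB_symmetric : forall z, B z -> B (- z) ;
  setB_int0 : (B°) 0 ;
  setB_normal : forall (i : 'I_N) (z : 'rV[R]_J),
    boundary B z -> `|dotv z (n i)| < delta ->
    forall nu : 'rV[R]_J, enorm nu = 1 ->
      (forall y, B y -> 0 <= dotv nu (y - z)) -> dotv nu (d i) = 0 }.

Definition setB_condition d n : Prop :=
  exists (delta : R) (B : set 'rV[R]_J), 0 < delta /\ is_setB d n delta B.

Record solves_derivative d n c (Z psi phi eta : R -> 'rV[R]_J) : Prop := {
  sder_phi : rcll phi ;
  sder_eta : rcll eta ;
  sder_init : lspan (dcone d n c (Z 0)) (eta 0) ;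
  sder_sum : forall t, 0 <= t -> phi t = psi t + eta t ;
  sder_in : forall t, 0 <= t -> Htan n c (Z t) (phi t) ;
  sder_incr : forall s t, 0 <= s -> s < t ->
    lspan (\bigcup_(u in `]s, t]) dcone d n c (Z u)) (eta t - eta s) }.

Definition sup_enorm (T : R) (f : R -> 'rV[R]_J) : \bar R :=
  ereal_sup [set (enorm (f s))%:E | s in `[0, T]].

End ESP.

(* Main.v *)
(* By linearity it suffices to bound the difference eta = eta1 - eta2, scaled so
   that |psi1 - psi2| <= delta / 4; then eta never leaves B. Indeed, whenever i
   is active at Z(t), <phi, n_i> = 0 gives |<eta(t), n_i>| <= delta / 4, so near
   the exit time the increments of eta are orthogonal to the normals of B that
   matter and cannot cross the boundary. Left limits of eta play no role: upper
   semicontinuity of the active set along Z confines the increments on both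
   sides of t to the span of the d_i with i active at Z(t). *)
Require Import Defs.
From HB Require Import structures.
From mathcomp Require Import all_boot all_order all_algebra.
From mathcomp Require Import all_classical all_reals all_analysis.
From mathcomp Require Import ring lra.

Set Implicit Arguments.
Unset Strict Implicit.
Unset Printing Implicit Defensive.

Import Order.TTheory GRing.Theory Num.Theory.
Import numFieldNormedType.Exports.

Local Open Scope classical_set_scope.
Local Open Scope ring_scope.

(** * Euclidean inner product and norm *)

Section InnerProduct.
Variables (R : realType) (J : nat).
Implicit Types u v w : 'rV[R]_J.

Lemma dotvC u v : dotv u v = dotv v u.
Proof. by apply: eq_bigr => k _; rewrite mulrC. Qed.

Lemma dotvDl u v w : dotv (u + v) w = dotv u w + dotv v w.
Proof. by rewrite -big_split; apply: eq_bigr => k _; rewrite mxE mulrDl. Qed.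

Lemma dotvZl a u w : dotv (a *: u) w = a * dotv u w.
Proof. by rewrite mulr_sumr; apply: eq_bigr => k _; rewrite mxE mulrA. Qed.

Lemma dotvDr u v w : dotv w (u + v) = dotv w u + dotv w v.
Proof. by rewrite dotvC dotvDl !(dotvC w). Qed.

Lemma dotvZr a u w : dotv w (a *: u) = a * dotv w u.
Proof. by rewrite dotvC dotvZl dotvC. Qed.

Lemma dotvNl u w : dotv (- u) w = - dotv u w.
Proof. by rewrite -scaleN1r dotvZl mulN1r. Qed.

Lemma dotvNr u w : dotv w (- u) = - dotv w u.
Proof. by rewrite dotvC dotvNl dotvC. Qed.

Lemma dotv0r u : dotv u 0 = 0.
Proof. by rewrite -(scale0r 0) dotvZr mul0r. Qed.

Lemma dotv_sumr u m (x : 'I_m -> 'rV[R]_J) :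
  dotv u (\sum_(k < m) x k) = \sum_(k < m) dotv u (x k).
Proof. exact: (big_morph (dotv u) (fun x y => dotvDr x y u) (dotv0r u)). Qed.

Definition dotvE := (dotvDl, dotvDr, dotvZl, dotvZr, dotvNl, dotvNr, dotv0r).

Lemma dotv_ge0 u : 0 <= dotv u u.
Proof. by apply: sumr_ge0 => k _; rewrite -expr2 sqr_ge0. Qed.

Lemma dotv_eq0 u : dotv u u = 0 -> u = 0.
Proof.
move=> /eqP; rewrite psumr_eq0 => [/allP u0|k _]; last by rewrite -expr2 sqr_ge0.
apply/rowP => k; rewrite mxE; apply/eqP.
by move: (u0 k (mem_index_enum k)); rewrite mulf_eq0 orbb.
Qed.

Lemma enorm_ge0 u : 0 <= enorm u.
Proof. exact: sqrtr_ge0. Qed.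

Lemma enorm_sqr u : enorm u ^+ 2 = dotv u u.
Proof. by rewrite sqr_sqrtr // dotv_ge0. Qed.

Lemma enorm0_eq0 u : enorm u = 0 -> u = 0.
Proof. by move=> u0; apply: dotv_eq0; rewrite -enorm_sqr u0 expr0n. Qed.

Lemma enormZ a u : enorm (a *: u) = `|a| * enorm u.
Proof. by rewrite /enorm !dotvE mulrA sqrtrM -expr2 ?sqr_ge0// sqrtr_sqr. Qed.

Lemma cauchy_schwarz u v : `|dotv u v| <= enorm u * enorm v.
Proof.
rewrite -ler_sqr ?nnegrE ?mulr_ge0 ?enorm_ge0// exprMn !enorm_sqr real_normK ?num_real//.
have [v0|v0] := eqVneq (dotv v v) 0.
  by rewrite (dotv_eq0 v0) !dotv0r expr0n mulr0.
have vp : 0 < dotv v v by rewrite lt_def v0 dotv_ge0.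
(* This square expands to [dotv v v] times the defect of the squared inequality. *)
have := dotv_ge0 (dotv v v *: u - dotv u v *: v).
rewrite !dotvE (dotvC v u) => h; rewrite -subr_ge0 -(pmulr_rge0 _ vp).
by apply: le_trans h _; rewrite le_eqVlt; apply/orP; left; apply/eqP; ring.
Qed.

Lemma enorm_triangle u v : enorm (u + v) <= enorm u + enorm v.
Proof.
rewrite -ler_sqr ?nnegrE ?addr_ge0 ?enorm_ge0// sqrrD !enorm_sqr !dotvE (dotvC v u).
have := le_trans (ler_norm _) (cauchy_schwarz u v); lra.
Qed.

Lemma dotv_cvg (T : Type) (F : set_system T) {FF : Filter F}
    (f g : T -> 'rV[R]_J) u v :
  f @ F --> u -> g @ F --> v -> dotv (f x) (g x) @[x --> F] --> dotv u v.
Proof.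
move=> fu gv; rewrite /dotv.
apply: cvg_big => [|k _]; first exact: add_continuous.
apply: cvgM.
  exact: (cvg_comp _ _ fu (@coord_continuous _ _ _ _ _ _)).
exact: (cvg_comp _ _ gv (@coord_continuous _ _ _ _ _ _)).
Qed.

End InnerProduct.

(** * Nearest points of compact convex sets *)

Section ConvexProjection.
Variables (R : realType) (J : nat) (B : set 'rV[R]_J).
Hypotheses (cB : compact B)
  (convB : convex_set (B : set (convex_lmodType 'rV[R]_J))).

Lemma convex_combination (a : R) y z :
  0 <= a -> a <= 1 -> B y -> B z -> B (z + a *: (y - z)).
Proof.
move=> a0 a1 By Bz.
have := @convB y z (Itv01 a0 a1); rewrite !inE => /(_ By Bz).
congr B; rewrite /conv/= scalerBl scale1r scalerBr.
by rewrite addrCA.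
Qed.

(** Compactness yields a minimizer of the squared distance to [x]. The inequality on inner products
    is its first-order condition: a direction [y - z] violating it would bring a nearby point of the
    segment closer to [x]. *)
Lemma convex_projection (x : 'rV[R]_J) : B !=set0 -> exists2 z, B z &
  forall y, B y -> enorm (z - x) <= enorm (y - x) /\ 0 <= dotv (z - x) (y - z).
Proof.
move=> B0.
have cf : {within B, continuous (fun y => dotv (y - x) (y - x))}.
  apply: continuous_subspaceT => y; apply: (dotv_cvg (F := nbhs y)).
    by apply: cvgB; [exact: cvg_id|exact: cvg_cst].
  by apply: cvgB; [exact: cvg_id|exact: cvg_cst].
have [z /set_mem Bz zmin] := EVT_min_rV B0 cB cf.
exists z => // y By; split.
  by rewrite /enorm ler_sqrt ?dotv_ge0// zmin// inE.
rewrite leNgt; apply/negP => a0.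
set a := dotv _ _ in a0; set b := dotv (y - z) (y - z).
have b0 : 0 <= b by exact: dotv_ge0.
have ba : 0 < b - a by lra.
(* This step decreases the squared distance to x, since t (2a + t b) < 0. *)
pose t := - a / (b - a).
have t0 : 0 < t by rewrite divr_gt0// oppr_gt0.
have t1 : t <= 1 by rewrite ler_pdivrMr// mul1r; lra.
have := zmin (z + t *: (y - z)).
rewrite inE => /(_ (convex_combination (ltW t0) t1 By Bz)).
have -> : z + t *: (y - z) - x = (z - x) + t *: (y - z) by rewrite addrAC.
have tb : t * (b - a) = - a by rewrite /t divfK// gt_eqF.
rewrite (dotvDl (z - x)) !(dotvDr (z - x)) !dotvZl !dotvZr (dotvC (y - z)) -/a -/b => h.
have : 0 <= t * (a + a + t * b) by rewrite !mulrDr; lra.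
rewrite pmulr_rge0//; nra.
Qed.

End ConvexProjection.

(** * Geometry of the set [B] *)

Section SetB.
Variables (R : realType) (J N : nat) (d n : 'I_N -> 'rV[R]_J).
Variables (delta : R) (B : set 'rV[R]_J).
Hypotheses (hn : forall i, enorm (n i) = 1) (delta0 : 0 < delta)
  (hB : is_setB d n delta B).

Lemma setB_0 : B 0.
Proof. exact: nbhs_singleton (setB_int0 hB). Qed.

(** Moving from [z] by [- e *: nu] makes the pairing with [nu] equal to [- e], so arbitrarily short
    moves leave [B]. *)
Lemma boundary_of_normal z nu : B z -> enorm nu = 1 ->
  (forall y, B y -> 0 <= dotv nu (y - z)) -> boundary B z.
Proof.
move=> Bz nu1 hnu; split; first exact: subset_closure.
move=> zint.
have : \forall e \near (0 : R)^'+, B (z - e *: nu).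
  have : (z - e *: nu) @[e --> 0^'+] --> z.
    rewrite -[X in _ --> X]subr0 -[X in _ - X](scale0r nu).
    apply: cvgB; first exact: cvg_cst.
    by apply: cvgZr_tmp; exact: cvg_within.
  exact.
move=> Be.
have : \forall e \near (0 : R)^'+, False.
  near=> e.
  have e0 : 0 < e by [].
  have := hnu (z - e *: nu); rewrite addrAC subrr add0r !dotvE -enorm_sqr nu1.
  have /[swap]/[apply] : B (z - e *: nu) by near: e.
  lra.
by move/filter_ex => [].
Unshelve. all: by end_near.
Qed.

(* Instead of a supporting hyperplane at the point of the segment from 0 to q on
   the boundary of B, use the nearest point of B to a point x = lam q outside B,
   but close to B: this is a boundary point whose normal is explicit. *)
Lemma setB_step (I : set 'I_N) p q : B p ->
  (forall i, I i -> `|dotv q (n i)| <= delta / 2) ->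
  (forall nu, (forall i, I i -> dotv nu (d i) = 0) -> dotv nu (q - p) = 0) ->
  B q.
Proof.
move=> Bp qn qp; apply: contrapT => Bq.
(* The segment from 0 to [q] is cut into [m] pieces, each shorter than [delta / 2]. *)
pose m := Num.bound (enorm q / (delta / 2)).
have qm : enorm q < m%:R * (delta / 2).
  rewrite -ltr_pdivrMr ?divr_gt0//.
  by apply: archi_boundP; rewrite divr_ge0 ?enorm_ge0// divr_ge0 ?ltW.
have m0 : 0 < m%:R :> R.
  rewrite -(pmulr_lgt0 _ (divr_gt0 delta0 (ltr0Sn R 1))).
  exact: le_lt_trans (enorm_ge0 q) qm.
have ex : exists k, `[< ~ B ((k%:R / m%:R) *: q) >].
  by exists m; apply/asboolP; rewrite divff ?gt_eqF// scale1r.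
(* The first grid point outside [B] is not 0, so it has a predecessor in [B]; hence [x] lies within
   one piece of [B]. *)
case: (ex_minnP ex) => -[|k] /asboolP; first by rewrite mul0r scale0r => /(_ setB_0).
set lam := _ / _ => Bx kmin.
set x := lam *: q in Bx.
have lam1 : lam <= 1.
  rewrite ler_pdivrMr// mul1r ler_nat; apply: kmin.
  by apply/asboolP; rewrite divff ?gt_eqF// scale1r.
have lam0 : 0 <= lam by rewrite divr_ge0.
have By : B ((k%:R / m%:R) *: q).
  apply: contrapT => /asboolP /kmin; by rewrite ltnn.
have [z Bz hz] := convex_projection (setB_compact hB) (setB_convex hB) x
  (ex_intro _ _ setB_0).
have zx : enorm (z - x) < delta / 2.
  apply: le_lt_trans (hz _ By).1 _.
  rewrite -scalerBl enormZ -mulrBl -natr1 opprD addNKr mulN1r normrN.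
  by rewrite ger0_norm ?invr_ge0 ?ler0n// mulrC ltr_pdivrMr// mulrC.
pose e := enorm (z - x).
have e0 : 0 < e.
  rewrite lt_def enorm_ge0 andbT; apply/eqP => /enorm0_eq0/eqP.
  by rewrite subr_eq0 => /eqP zx'; apply: Bx; rewrite -zx'.
pose nu := e^-1 *: (z - x).
have nu1 : enorm nu = 1.
  by rewrite enormZ ger0_norm ?invr_ge0 ?ltW// mulVf// gt_eqF.
have hnu y : B y -> 0 <= dotv nu (y - z).
  by move=> /hz[_ h]; rewrite dotvZl mulr_ge0// invr_ge0 ltW.
have nud i : I i -> dotv nu (d i) = 0.
  move=> Ii; apply: (setB_normal hB (boundary_of_normal Bz nu1 hnu)) => //.
  (* Each summand contributes at most [delta / 2] to the pairing with [n i], the first one strictly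
     less. *)
  have -> : z = (z - x) + lam *: q by rewrite subrK.
  rewrite (dotvDl (z - x)) dotvZl (le_lt_trans (ler_normD _ _))//.
  have := cauchy_schwarz (z - x) (n i); rewrite hn mulr1 => h1.
  have : `|lam * dotv q (n i)| <= delta / 2.
    rewrite normrM ger0_norm//; have := qn _ Ii.
    move: `|_| (normr_ge0 (dotv q (n i))) => r r0 rd; nra.
  move=> h2; have := le_lt_trans h1 zx; lra.
have nuzx : dotv nu (z - x) = e.
  by rewrite dotvZl -enorm_sqr -/e expr2 mulrA mulVf ?mul1r// gt_eqF.
(* With P = Q the facts read Z = lam Q + e, Z <= 0 and Z <= Q. The first two force Q < 0, so lam Q
   >= Q as lam <= 1, and then Z > Q, a contradiction. *)
clearbody nu; move: nuzx (hnu _ setB_0) (hnu _ Bp) (qp _ nud).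
rewrite /x !dotvE; move: (dotv nu q) (dotv nu z) (dotv nu p) => Q Z P h1 h2 h3 h4.
have Q0 : Q < 0.
  by rewrite ltNge; apply/negP => /(mulr_ge0 lam0); lra.
have : 0 <= (lam - 1) * Q by rewrite mulr_le0 ?subr_le0// ltW.
rewrite mulrBl mul1r; lra.
Qed.

Lemma setB_bounded : exists2 K : R, 0 <= K & forall y, B y -> enorm y <= K.
Proof.
have cf : {within B, continuous (fun y : 'rV[R]_J => dotv y y)}.
  by apply: continuous_subspaceT => y; apply: (dotv_cvg (F := nbhs y)); exact: cvg_id.
have [z Bz zmax] := EVT_max_rV (ex_intro _ _ setB_0) (setB_compact hB) cf.
exists (enorm z); first exact: enorm_ge0.
by move=> y By; rewrite /enorm ler_sqrt ?dotv_ge0// zmax// inE.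
Qed.

End SetB.

(** * Active faces and directions of reflection *)

Section ActiveSets.
Variables (R : realType) (J N : nat).
Variables (d n : 'I_N -> 'rV[R]_J) (c : 'I_N -> R).

Lemma lspan_orthogonal (A : set 'rV[R]_J) nu v :
  (forall x, A x -> dotv nu x = 0) -> lspan A v -> dotv nu v = 0.
Proof.
move=> nuA [m [a [x [Ax ->]]]]; rewrite dotv_sumr big1// => k _.
by rewrite dotvZr nuA ?mulr0.
Qed.

Lemma dcone_orthogonal x nu v : (forall i, active n c x i -> dotv nu (d i) = 0) ->
  dcone d n c x v -> dotv nu v = 0.
Proof.
move=> nud; rewrite /dcone; case: ifP => _; last by move=> ->; rewrite dotv0r.
move=> [m [a [y [ay ->]]]]; rewrite dotv_sumr big1// => k _.
by case: (ay k) => _ [i ii <-]; rewrite dotvZr nud ?mulr0.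
Qed.

Lemma Htan_active x y i : Htan n c x y -> active n c x i -> dotv y (n i) = 0.
Proof.
move=> + xi; have bx : boundary (polyhedron n c) x by exact: xi.1.
by rewrite /Htan mem_set// => /(_ i xi).
Qed.

Lemma closed_face i : closed (face n c i).
Proof.
have -> : face n c i = closure (polyhedron n c) `&` ~` (polyhedron n c)°
    `&` (fun x => dotv x (n i)) @^-1` [set c i].
  by [].
apply: closedI; last first.
  apply: preimage_closed; last exact: closed_eq.
  by move=> x _; apply: (dotv_cvg (F := nbhs x)); [exact: cvg_id|exact: cvg_cst].
apply: closedI; first exact: closed_closure.
exact/open_closedC/open_interior.
Qed.

(** Faces are closed, so by continuity [Z] stays off each face inactive at [t] for a while; finitely
    many faces allow a common [e]. *)
Lemma active_usc (Z : R -> 'rV[R]_J) t : continuous_path Z -> 0 <= t ->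
  exists2 e : R, 0 < e & forall u, 0 <= u -> `|t - u| < e ->
    active n c (Z u) `<=` active n c (Z t).
Proof.
move=> cZ t0.
have {}cZ : Z @ within `[0, +oo[ (nbhs t) --> Z t.
  by move/subspace_continuousP : cZ; apply; rewrite /= in_itv/= t0.
have : \forall u \near within `[0, +oo[ (nbhs t), forall i : 'I_N,
    active n c (Z u) i -> active n c (Z t) i.
  apply: (@filter_forall _ _ _ _ _) => i.
  have [ti|ti] := pselect (active n c (Z t) i); first by near=> u.
  have : nbhs (Z t) (~` face n c i).
    by apply: open_nbhs_nbhs; split => //; exact/closed_openC/closed_face.
  move/cZ; apply: (@filterS _ (within `[0, +oo[ (nbhs t)) _) => u /= nu.
  by move/nu.
move=> /nbhs_ballP[e /= e0 he]; exists e => // u u0 tu.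
by apply: he => //=; rewrite in_itv/= u0.
Unshelve. all: by end_near.
Qed.

End ActiveSets.

(** * Confinement of the scaled difference to [B] *)

Section Confinement.
Variables (R : realType) (J N : nat) (d n : 'I_N -> 'rV[R]_J) (c : 'I_N -> R).
Variables (delta : R) (B : set 'rV[R]_J) (Z eta : R -> 'rV[R]_J) (T : R).
Hypotheses (hn : forall i, enorm (n i) = 1) (delta0 : 0 < delta)
  (hB : is_setB d n delta B) (cZ : continuous_path Z).
Hypothesis eta_right : forall t, 0 <= t -> eta s @[s --> t^'+] --> eta t.
(** Membership in a span enters dually, through the vectors [nu] orthogonal to the active
    directions: this is the form [setB_step] asks for, and it passes to differences and multiples of
    solutions. *)
Hypothesis eta_init : forall nu,
  (forall i, active n c (Z 0) i -> dotv nu (d i) = 0) -> dotv nu (eta 0) = 0.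
Hypothesis eta_incr : forall s t nu, 0 <= s -> s < t ->
  (forall u i, s < u -> u <= t -> active n c (Z u) i -> dotv nu (d i) = 0) ->
  dotv nu (eta t - eta s) = 0.
Hypothesis eta_face : forall t i, 0 <= t -> t <= T -> active n c (Z t) i ->
  `|dotv (eta t) (n i)| <= delta / 4.

Let lt_delta_half : delta / 4 < delta / 2.
Proof. by move: delta0; lra. Qed.

(** [setB_step] applies from [eta t] to [eta u]: right continuity spends the margin between
    [delta / 4] and [delta / 2], and active sets just after [t] are contained in the one at [t]. *)
Lemma setB_extend_right t : 0 <= t -> t <= T -> B (eta t) ->
  exists2 e : R, 0 < e & forall u, t < u -> u < t + e -> B (eta u).
Proof.
move=> t0 tT Bt; have [e e0 he] := active_usc n c cZ t0.
have [e' /= e'0 he'] : \forall u \near t^'+, forall i,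
    active n c (Z t) i -> `|dotv (eta u) (n i)| <= delta / 2.
  apply: (@filter_forall _ _ _ _ _) => i.
  have [ti|ti] := pselect (active n c (Z t) i); last by near=> u.
  have : `|dotv (eta u) (n i)| @[u --> t^'+] --> `|dotv (eta t) (n i)|.
    apply: cvg_norm; apply: (dotv_cvg (F := t^'+)); [exact: eta_right|exact: cvg_cst].
  move=> /cvgr_le/(_ _ (le_lt_trans (eta_face t0 tT ti) lt_delta_half)).
  by apply: (@filterS _ t^'+ _) => u /=.
exists (Num.min e e'); first by rewrite lt_min e0 e'0.
move=> u tu; rewrite -ltrBlDl lt_min => /andP[ue ue'].
have absE v : t < v -> `|t - v| = v - t.
  by move=> tv; rewrite distrC ger0_norm// subr_ge0 ltW.
apply: (setB_step hn delta0 hB (I := active n c (Z t)) Bt).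
  by move=> i; apply: he' => //=; rewrite absE.
move=> nu nud; apply: eta_incr => // v i tv vu vi; apply: nud.
apply: he vi; first exact: le_trans (ltW tv).
by rewrite absE//; apply: le_lt_trans ue; rewrite lerD2r.
Unshelve. all: by end_near.
Qed.

(** [setB_step] applies to the increment ending at [t], started from a slightly earlier time, or
    from the point 0 of [B] when [t] is 0. *)
Lemma setB_extend_left t : 0 <= t -> t <= T ->
  (forall s, 0 <= s -> s < t -> B (eta s)) -> B (eta t).
Proof.
move=> t0 tT Bs.
have face i : active n c (Z t) i -> `|dotv (eta t) (n i)| <= delta / 2.
  by move=> ti; apply/ltW/(le_lt_trans (eta_face t0 tT ti)).
have [t00|t_neq0] := eqVneq t 0.
  apply: (setB_step hn delta0 hB (I := active n c (Z t)) (setB_0 hB)) => // nu.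
  by rewrite t00 subr0; exact: eta_init.
have [e e0 he] := active_usc n c cZ t0.
(* Nonnegative, and so close to [t] that [he] covers all of []s, t]]. *)
pose s := Num.max 0 (t - e / 2).
have s0 : 0 <= s by rewrite le_max lexx.
have st : s < t by rewrite gt_max lt_def t_neq0 t0/=; lra.
apply: (setB_step hn delta0 hB (I := active n c (Z t)) (Bs _ s0 st)) => // nu nud.
apply: eta_incr => // u i su ut ui; apply: nud; apply: he ui.
  exact: le_trans (ltW su).
rewrite ger0_norm ?subr_ge0//.
have : t - e / 2 <= s by rewrite le_max lexx orbT.
lra.
Qed.

(** Consider the infimum [m] of the times spent outside [B]. Left extension puts [eta m] in [B], and
    right extension then keeps such times from accumulating at [m]. *)
Lemma setB_confined t : 0 <= t -> t <= T -> B (eta t).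
Proof.
move=> t0 tT; apply: contrapT => Bt.
pose E := [set s | [/\ 0 <= s, s <= T & ~ B (eta s)]].
have Et : E t by [].
have infE : has_inf E by split; [exists t|exists 0 => s []].
set m := inf E.
have m0 : 0 <= m by apply: lb_le_inf; [exists t|move=> s []].
have mT : m <= T by apply: le_trans tT; apply: ge_inf => //; exact: infE.2.
have Bm : B (eta m).
  apply: setB_extend_left => // s s0 sm; apply: contrapT => Bs.
  have : m <= s.
    by apply: ge_inf; [exact: infE.2|split => //; exact: le_trans (ltW sm) mT].
  by rewrite leNgt sm.
have [e e0 he] := setB_extend_right m0 mT Bm.
have [u Eu ume] := inf_adherent e0 infE.
have mu : m <= u by apply: ge_inf => //; exact: infE.2.
case: Eu => _ _; apply.
by move: mu; rewrite le_eqVlt => /predU1P[<-//|mu]; exact: he.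
Qed.

End Confinement.

(** * The Lipschitz estimate with a real bound *)

Section Lipschitz.
Variables (R : realType) (J N : nat) (d n : 'I_N -> 'rV[R]_J) (c : 'I_N -> R).

Lemma derivative_problem_lipschitz (Z : R -> 'rV[R]_J) :
  (forall i, enorm (n i) = 1) -> continuous_path Z -> setB_condition d n ->
  exists2 kappa : R, 0 < kappa & forall psi1 psi2 phi1 phi2 eta1 eta2 T b,
    solves_derivative d n c Z psi1 phi1 eta1 ->
    solves_derivative d n c Z psi2 phi2 eta2 ->
    (forall s, 0 <= s -> s <= T -> enorm (psi1 s - psi2 s) <= b) ->
    forall s, 0 <= s -> s <= T -> enorm (phi1 s - phi2 s) <= kappa * b.
Proof.
move=> hn cZ [delta [B [delta0 hB]]].
have [K K0 BK] := setB_bounded hB.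
(* The 1 pays for the [psi] difference. The rest comes from undoing the scaling by [M]: a point of
   [B] has norm at most [K], and [K / M] is [4 * K / delta * b]. *)
pose kappa := 1 + 4 * K / delta.
have kappa0 : 0 < kappa by rewrite ltr_pwDl// divr_ge0 ?mulr_ge0// ltW.
exists kappa => // psi1 psi2 phi1 phi2 eta1 eta2 T b0 sol1 sol2 psib0 s s0 sT.
have phiE t : 0 <= t ->
    phi1 t - phi2 t = (psi1 t - psi2 t) + (eta1 t - eta2 t).
  by move=> t0; rewrite (sder_sum sol1 t0) (sder_sum sol2 t0) opprD addrACA.
(* Enlarging b0 makes the scaling factor M meaningful when b0 = 0. *)
rewrite -ler_pdivrMl//; apply/ler_addgt0Pr => e e0.
rewrite ler_pdivrMl//; set b := b0 + e.
have b00 : 0 <= b0 by exact: le_trans (enorm_ge0 _) (psib0 _ s0 sT).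
have b_gt0 : 0 < b by rewrite ltr_wpDl.
have psib t : 0 <= t -> t <= T -> enorm (psi1 t - psi2 t) <= b.
  by move=> t0 tT; apply: le_trans (psib0 _ t0 tT) _; rewrite lerDl ltW.
pose M := delta / (4 * b).
have M0 : 0 < M by rewrite divr_gt0// mulr_gt0.
pose eta t := M *: (eta1 t - eta2 t).
have Bs : B (eta s).
  apply: (setB_confined (c := c) (T := T) hn delta0 hB cZ) => //.
  - move=> t t0; apply: cvgZl_tmp; apply: cvgB.
      exact: (sder_eta sol1).1.
    exact: (sder_eta sol2).1.
  - move=> nu nud; rewrite /eta dotvZr dotvDr dotvNr.
    rewrite (lspan_orthogonal _ (sder_init sol1)); last first.
      by move=> x; exact: dcone_orthogonal.
    rewrite (lspan_orthogonal _ (sder_init sol2)) ?subrr ?mulr0// => x.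
    exact: dcone_orthogonal.
  - move=> r t nu r0 rt nud.
    have nud' x : (\bigcup_(u in `]r, t]) dcone d n c (Z u)) x -> dotv nu x = 0.
      move=> [u]; rewrite /= in_itv/= => /andP[ru ut].
      by apply: dcone_orthogonal => i; exact: nud.
    have := lspan_orthogonal nud' (sder_incr sol1 r0 rt).
    have := lspan_orthogonal nud' (sder_incr sol2 r0 rt).
    rewrite /eta !dotvE => h2 h1.
    suff -> : dotv nu (eta1 t) - dotv nu (eta2 t) =
        dotv nu (eta1 r) - dotv nu (eta2 r) by rewrite subrr.
    by lra.
  - move=> t i t0 tT ti.
    rewrite /eta; have -> : eta1 t - eta2 t = (phi1 t - phi2 t) - (psi1 t - psi2 t).
      by rewrite phiE// addrAC subrr add0r.
    rewrite dotvZl dotvDl dotvDl !dotvNl.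
    rewrite (Htan_active (sder_in sol1 t0) ti) (Htan_active (sder_in sol2 t0) ti).
    rewrite subrr add0r normrM normrN gtr0_norm//.
    have := cauchy_schwarz (psi1 t - psi2 t) (n i); rewrite hn mulr1.
    move=> /le_trans/(_ (psib _ t0 tT)) h.
    have -> : delta / 4 = M * b by rewrite /M; field; rewrite gt_eqF.
    by rewrite ler_pM2l.
rewrite phiE// (le_trans (enorm_triangle _ _))// mulrDl mul1r lerD ?psib//.
have -> : 4 * K / delta * b = M^-1 * K.
  by rewrite /M; field; rewrite !gt_eqF.
rewrite -ler_pdivrMl ?invr_gt0// invrK.
by have := BK _ Bs; rewrite enormZ gtr0_norm.
Qed.

End Lipschitz.

(** * Extended suprema and uniqueness *)

Theorem theorem5p4 (R : realType) (J N : nat)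
    (d n : 'I_N -> 'rV[R]_J) (c : 'I_N -> R) (X Z Y : R -> 'rV[R]_J)
    (hdata : ESP_data d n c)
    (hX : continuous_path X) (hX0 : polyhedron n c (X 0))
    (hZY : solves_ESP d n c X Z Y)
    (hB : setB_condition d n) :
  (exists kappa : R, 0 < kappa /\
     forall psi1 psi2 phi1 phi2 eta1 eta2 : R -> 'rV[R]_J,
       rcll psi1 -> rcll psi2 ->
       solves_derivative d n c Z psi1 phi1 eta1 ->
       solves_derivative d n c Z psi2 phi2 eta2 ->
       forall T : R, 0 <= T ->
         (sup_enorm T (fun s => (phi1 s - phi2 s)%R)
            <= kappa%:E * sup_enorm T (fun s => (psi1 s - psi2 s)%R))%E) /\
  (forall psi phi1 phi2 eta1 eta2 : R -> 'rV[R]_J,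
     rcll psi ->
     solves_derivative d n c Z psi phi1 eta1 ->
     solves_derivative d n c Z psi phi2 eta2 ->
     forall t : R, 0 <= t -> phi1 t = phi2 t /\ eta1 t = eta2 t).
Proof.
have [kappa kappa0 lip] :=
  derivative_problem_lipschitz c (ESP_unit hdata) (sESP_Z hZY) hB.
split.
  exists kappa; split => // psi1 psi2 phi1 phi2 eta1 eta2 _ _ sol1 sol2 T T0.
  set S := sup_enorm T (fun s => psi1 s - psi2 s).
  have psiS s : 0 <= s -> s <= T -> ((enorm (psi1 s - psi2 s))%:E <= S)%E.
    by move=> s0 sT; apply: ereal_sup_ubound; exists s => //=; rewrite in_itv/= s0.
  apply: ge_ereal_sup => x [s /=]; rewrite in_itv/= => /andP[s0 sT] <-.
  (* An infinite [S] makes the right side infinite because [kappa] is positive; the value -oo is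
     excluded by time 0. *)
  case: S psiS => [b||] psiS.
  - rewrite -EFinM lee_fin; apply: (lip _ _ _ _ _ _ _ _ sol1 sol2) s0 sT.
    by move=> u u0 uT; rewrite -lee_fin psiS.
  - by rewrite gt0_muley ?lte_fin// leey.
  - by have := psiS _ (lexx 0) T0.
move=> psi phi1 phi2 eta1 eta2 _ sol1 sol2 t t0.
have phi12 : phi1 t = phi2 t.
  (* Uniqueness is the estimate on [[0, t]] with bound 0. *)
  apply/eqP; rewrite -subr_eq0; apply/eqP/enorm0_eq0/le_anti.
  rewrite enorm_ge0 andbT -(mulr0 kappa).
  apply: (lip _ _ _ _ _ _ _ _ sol1 sol2) t0 (lexx t) => s _ _.
  by rewrite subrr /enorm dotv0r sqrtr0.
split=> //; apply: (addrI (psi t)).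
by rewrite -(sder_sum sol1 t0) -(sder_sum sol2 t0).
Qed.
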